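(* Let $q,a,u,v,x$ be indeterminates (generic parameters) and let $r\ge0$ be an integer. Define $H_r$ by $$\frac{(u;q)_r}{(q;q)_r}H_r=\sum_{i=0}^r a^{r-i}\frac{(u;q)_{r-i}}{(q;q)_{r-i}}\ {}_2\phi_1\!\left[\begin{matrix}q^{i-r},\ v\\ q^{1+i-r}/v\end{matrix};q,\frac{q}{v^2a^2}\right]\frac{(x;q)_i}{(q;q)_i}\,\frac{(uq^{r-i};q)_i}{(vq^{r-i+1};q)_i}\,\frac{(v^2q^{2r-i+1};q)_i}{(xv^2q^{2r-i};q)_i}.$$ Then $$H_r=(-1/v)^r\,\frac{(xv^2;q)_r}{(xv^2;q)_{2r}}\,\frac{(x^2v^2;q^2)_r\,(v^2q;q^2)_r}{(xv;q)_r}\ {}_4\phi_3\!\left[\begin{matrix}q^{-r},\ xv^2q^r,\ -av,\ -1/a\\ vq^{1/2},\ -vq^{1/2},\ -xv\end{matrix};q,q\right].$$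
   Context: For an indeterminate $b$ and integer $k\ge 0$, $(b;q)_k=\prod_{j=0}^{k-1}(1-bq^j)$ (with $q$ replaced by $q^2$ in $(b;q^2)_k$). The basic hypergeometric series is ${}_{s+1}\phi_s\!\left[\begin{matrix}a_1,\dots,a_{s+1}\\ b_1,\dots,b_s\end{matrix};q,z\right]=\sum_{i\ge0}\frac{(a_1;q)_i\cdots(a_{s+1};q)_i}{(b_1;q)_i\cdots(b_s;q)_i}\frac{z^i}{(q;q)_i}$, terminating when some numerator parameter is $q^{-m}$, $m\ge0$ an integer. *)

(* Defs.v *)
From mathcomp Require Import all_boot all_order all_algebra.

Set Implicit Arguments.
Unset Strict Implicit.
Unset Printing Implicit Defensive.

Import GRing.Theory.
Local Open Scope ring_scope.

Section QSeries.
Variable F : fieldType.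
Implicit Types (b q z : F) (A B : seq F).

Definition qpoch b q (k : nat) : F := \prod_(j < k) (1 - b * q ^+ j).

(* [A] and [B] list the numerator and denominator parameters. *)
Definition bhs_term A B q z (i : nat) : F :=
  (\prod_(c <- A) qpoch c q i) / (\prod_(c <- B) qpoch c q i)
  * (z ^+ i / qpoch q q i).

(* The series terminated at index [m]. When q^{-m} is a numerator parameter,
   this is the sum over all i >= 0: see [bhs_term_eq0] and [bhs_stable]. *)
Definition bhs (m : nat) A B q z : F := \sum_(i < m.+1) bhs_term A B q z i.

Lemma bhs_term_eq0 (m i : nat) A B q z :
  q != 0 -> q ^- m \in A -> (m < i)%N -> bhs_term A B q z i = 0.
Proof.
move=> q0 mA ltmi; rewrite /bhs_term (big_rem _ mA) /=.
by rewrite {1}/qpoch (bigD1 (Ordinal ltmi)) //= mulVf ?expf_neq0 // subrr !mul0r.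
Qed.

Lemma bhs_stable (m n : nat) A B q z :
  q != 0 -> q ^- m \in A -> (m <= n)%N -> bhs n A B q z = bhs m A B q z.
Proof.
move=> q0 mA lemn; rewrite /bhs -!(big_mkord xpredT (bhs_term A B q z)).
rewrite (big_cat_nat (n := m.+1)) //= [X in _ + X]big_nat_cond.
rewrite [X in _ + X]big1 ?addr0 // => i /andP[/andP[ltmi _] _].
exact: bhs_term_eq0 ltmi.
Qed.

End QSeries.

(* Main.v *)
Require Import Defs.
From mathcomp Require Import all_boot all_order all_algebra.
From mathcomp Require Import ring zify.

(** The parameter [u] cancels, and [a ^ n] times the 2phi1 of index [n] is a Rogers
    (continuous q-ultraspherical) polynomial of degree [n] with parameter [v].
    Comparing three-term recurrences expands it in the Askey-Wilson basis
    [(-av;q)_k (-1/a;q)_k] (the case [x = 1] of the theorem). After exchanging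
    the sums, the coefficient of each basis element is a terminating
    very-well-poised 6phi5 sum in [w = v q^k], evaluated by the WZ method.
    In these two identities the coefficients are arranged so that the only
    denominators are powers of [q] and [v] and the symbols [(q;q)_n]: the factors
    [(-v;q)_k] of the 4phi3 at [x = 1] may vanish and must not be divided by. *)

Set Implicit Arguments.
Unset Strict Implicit.
Unset Printing Implicit Defensive.

Import GRing.Theory.
Local Open Scope ring_scope.

(** Proves an equation from one relation [a = b] by giving its multiplier [c]; what remains is an
    unconditional identity for [ring] or [field]. *)
Lemma lincomb (R : pzRingType) (x y c a b : R) :
  a = b -> x - y = c * (a - b) -> x = y.
Proof. by move=> -> /eqP; rewrite subrr mulr0 subr_eq0 => /eqP. Qed.

(** * Sums over the antidiagonals [j + k = n] *)

Section AntidiagonalSums.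
Variable V : nmodType.
Implicit Types (h : nat -> nat -> V) (n : nat).

Definition adsum n h : V := \sum_(k < n.+1) h (n - k)%N k.

(** Padding with 0 lets a recurrence in [n] be stated pointwise on one antidiagonal, boundary
    included. *)
Definition shiftl h (j k : nat) : V := if j is j'.+1 then h j' k else 0.
Definition shiftr h (j k : nat) : V := if k is k'.+1 then h j k' else 0.

Lemma eq_adsum n h h' :
  (forall j k, (j + k = n)%N -> h j k = h' j k) -> adsum n h = adsum n h'.
Proof. by move=> e; apply: eq_bigr => -[k lek] _; apply: e; rewrite subnK. Qed.

Lemma adsum0 h : adsum 0 h = h 0%N 0%N.
Proof. by rewrite /adsum big_ord1. Qed.

Lemma adsum_shiftl n h : adsum n.+1 (shiftl h) = adsum n h.
Proof.
rewrite /adsum big_ord_recr /= subnn addr0.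
by apply: eq_bigr => -[k lek] _ /=; rewrite subSn.
Qed.

Lemma adsum_shiftr n h : adsum n.+1 (shiftr h) = adsum n h.
Proof. by rewrite /adsum big_ord_recl /= add0r. Qed.

Lemma sum_triangle n h :
  \sum_(i < n.+1) \sum_(k < i.+1) h i k
  = \sum_(k < n.+1) \sum_(m < (n - k).+1) h (k + m)%N k.
Proof.
elim: n => [|n IH]; first by rewrite !big_ord1.
rewrite [LHS]big_ord_recr IH /= [X in _ + X = _]big_ord_recr /= addrA -big_split /=.
rewrite [RHS]big_ord_recr /= subnn big_ord1 addn0; congr (_ + _).
apply: eq_bigr => -[k lek] _ /=.
by rewrite subSn // [RHS]big_ord_recr /= addnS subnKC.
Qed.

End AntidiagonalSums.

Section AntidiagonalRing.
Variable R : pzRingType.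
Implicit Types (h : nat -> nat -> R) (n : nat).

Lemma adsumD n h h' : adsum n (fun j k => h j k + h' j k) = adsum n h + adsum n h'.
Proof. by rewrite /adsum big_split. Qed.

Lemma adsumB n h h' : adsum n (fun j k => h j k - h' j k) = adsum n h - adsum n h'.
Proof. by rewrite /adsum -sumrB. Qed.

Lemma adsumZ n c h : adsum n (fun j k => c * h j k) = c * adsum n h.
Proof. by rewrite /adsum mulr_sumr. Qed.

End AntidiagonalRing.

(** * q-shifted factorials and their reversal *)

Section QPochhammer.
Variables (F : fieldType) (q : F).
Implicit Types (b c : F) (j k m n : nat).

Lemma qpoch0 b : qpoch b q 0 = 1.
Proof. by rewrite /qpoch big_ord0. Qed.

Lemma qpochSr b n : qpoch b q n.+1 = qpoch b q n * (1 - b * q ^+ n).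
Proof. by rewrite /qpoch big_ord_recr. Qed.

Lemma qpochSl b n : qpoch b q n.+1 = (1 - b) * qpoch (b * q) q n.
Proof.
rewrite /qpoch big_ord_recl expr0 mulr1; congr (_ * _).
by apply: eq_bigr => i _; rewrite exprS mulrA.
Qed.

Lemma qpochD b m n : qpoch b q (m + n) = qpoch b q m * qpoch (b * q ^+ m) q n.
Proof.
elim: n => [|n IH]; first by rewrite addn0 qpoch0 mulr1.
by rewrite addnS !qpochSr IH -mulrA -[b * _ * _]mulrA -exprD.
Qed.

Lemma qpoch_neq0_le b m n : (m <= n)%N -> qpoch b q n != 0 -> qpoch b q m != 0.
Proof. by move=> /subnKC <-; rewrite qpochD mulf_eq0 negb_or => /andP[]. Qed.

Lemma qpochM_opp b n : qpoch b q n * qpoch (- b) q n = qpoch (b ^+ 2) (q ^+ 2) n.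
Proof.
rewrite /qpoch -big_split; apply: eq_bigr => i _ /=.
by rewrite -exprM mulnC exprM; ring.
Qed.

(** The product of [q ^+ i] for [j <= i < j + k], which appears when [k] factors are reversed. *)
Definition qtri j k : F := q ^+ (j * k + 'C(k, 2)).

Lemma qtri0r j : qtri j 0 = 1. Proof. by rewrite /qtri muln0. Qed.
Lemma qtriSl j k : qtri j.+1 k = qtri j k * q ^+ k.
Proof. by rewrite /qtri -exprD; congr (_ ^+ _); lia. Qed.

Lemma qtriSr j k : qtri j k.+1 = qtri j k * q ^+ j * q ^+ k.
Proof. by rewrite /qtri binS bin1 -!exprD; congr (_ ^+ _); lia. Qed.

Lemma qtriDl i j k : qtri (i + j) k = qtri i k * q ^+ (j * k).
Proof. by rewrite /qtri -exprD; congr (_ ^+ _); lia. Qed.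

(** Each of the last [k] factors [1 - b q^i] equals [- b q^i (1 - q^-i / b)]; read backwards, the
    brackets form the last symbol. *)
Lemma qpoch_rev b j k : q != 0 -> b != 0 ->
  qpoch b q (j + k)
  = qpoch b q j * (- b) ^+ k * qtri j k * qpoch (q / (q ^+ (j + k) * b)) q k.
Proof.
move=> q0 b0; elim: k => [|k IH]; first by rewrite addn0 qtri0r !qpoch0 !mulr1.
have qj : q ^+ j != 0 by rewrite expf_neq0.
have qk : q ^+ k != 0 by rewrite expf_neq0.
have -> : qpoch (q / (q ^+ (j + k.+1) * b)) q k.+1
        = (1 - (q ^+ (j + k) * b)^-1) * qpoch (q / (q ^+ (j + k) * b)) q k.
  by rewrite qpochSl addnS exprS exprD; congr ((1 - _) * qpoch _ _ _);
     field; rewrite ?q0 ?b0 ?qj ?qk.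
rewrite addnS qpochSr IH qtriSr !exprD exprS.
by field; rewrite ?q0 ?b0 ?qj ?qk.
Qed.

(** Moves inverse q-factorials to the largest index in use, where they can stay atoms for [ring]. *)
Lemma qfactV n : qpoch q q n.+1 != 0 ->
  (qpoch q q n)^-1 = (1 - q ^+ n.+1) * (qpoch q q n.+1)^-1.
Proof.
rewrite qpochSr -exprS mulf_eq0 negb_or => /andP[_ h].
by rewrite invfM mulrCA divff // mulr1.
Qed.

End QPochhammer.

(** * The terminating very-well-poised 6phi5 sum *)

Section Sum65.
Variables (F : fieldType) (q w x : F).

(* With [N = j + m], the [m]-th term of the 6phi5 with base [w^2] and parameters
   [-w], [x w^2 q^N], [q^-N], up to a factor independent of [m]. *)
Definition sum65_term j m : F :=
  qpoch x q j * ((qpoch q q m)^-1 * (qpoch q q j)^-1) * (1 - w * q ^+ m)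
  * qpoch (w ^+ 2) q m * qpoch (w ^+ 2 * q ^+ (j + m + m + 1)) q j
  * qpoch (x * w ^+ 2 * q ^+ (j + m)) q m * (- w) ^+ j.

(** The WZ certificate: on [j + m = N.+1], its two shifts are consecutive values in [m] of one
    function, so their difference telescopes. *)
Definition sum65_cert j m : F :=
  (1 - w * q ^+ (j + m + 1)) * (1 - x * w ^+ 2 * q ^+ (j + m + (j + m) + 1))
  * qpoch x q j * ((qpoch q q m)^-1 * (qpoch q q j)^-1)
  * qpoch (w ^+ 2) q m.+1 * qpoch (w ^+ 2 * q ^+ (j + m + m + 2)) q j
  * qpoch (x * w ^+ 2 * q ^+ (j + m + 1)) q m * (- w) ^+ j.

(** [1 - q^(N+1)] times the quotient of the closed forms of [sum65] at [N.+1] and [N]. *)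
Definition sum65_ratio N : F :=
  (1 + x * w * q ^+ N) * (1 - w ^+ 2 * q ^+ (N + N + 1)) * (1 - w * q ^+ (N + 1)).

Lemma sum65_wz N j m : qpoch q q N.+1 != 0 -> (j + m = N.+1)%N ->
  (1 - q ^+ N.+1) * sum65_term j m
  = sum65_ratio N * shiftl sum65_term j m
    - shiftl sum65_cert j m + shiftr sum65_cert j m.
Proof.
move=> qN e.
have qj : qpoch q q j != 0 by apply: qpoch_neq0_le qN; lia.
have qm : qpoch q q m != 0 by apply: qpoch_neq0_le qN; lia.
rewrite /sum65_term /sum65_cert /sum65_ratio.
have pSr c i n : qpoch (c * q ^+ i) q n.+1
    = qpoch (c * q ^+ i) q n * (1 - c * q ^+ (i + n)).
  by rewrite qpochSr -mulrA -exprD.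
have pSl c i n : qpoch (c * q ^+ i) q n.+1
    = (1 - c * q ^+ i) * qpoch (c * q ^+ i.+1) q n.
  by rewrite qpochSl -mulrA -exprSr.
case: j e qj => [|j] e qj.
  case: m e qm => // m [<-] qm.
  rewrite /= (qfactV qm) !qpoch0 !add0n !addn1 pSr [qpoch (w ^+ 2) _ _]qpochSr.
  by rewrite !(addnS, addSn, addn0, add0n, exprS, exprD); ring.
have -> : N = (j + m)%N by lia.
set A := qpoch (w ^+ 2 * q ^+ (j + m + m + 2)) q j.
have E1 : qpoch (w ^+ 2 * q ^+ (j.+1 + m + m + 1)) q j.+1
    = A * (1 - w ^+ 2 * q ^+ (j + m + (j + m) + 2)).
  by rewrite pSr /A; congr (qpoch (_ * _ ^+ _) _ _ * (1 - _ * _ ^+ _)); lia.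
(* Compares, without dividing, two symbols of length [j] whose bases differ by a factor [q]. The
   left factor comes from [sum65_ratio], and [c] below is what multiplies this left side in the
   identity. *)
have E2 : (1 - w ^+ 2 * q ^+ (j + m + (j + m) + 1))
      * qpoch (w ^+ 2 * q ^+ (j + m + m + 1)) q j
    = (1 - w ^+ 2 * q ^+ (j + m + m + 1)) * A.
  rewrite /A (_ : (j + m + m + 2 = (j + m + m + 1).+1)%N); last by lia.
  by rewrite -pSl pSr mulrC; congr (_ * (1 - _ * _ ^+ _)); lia.
rewrite E1 /= -/A (qfactV qj).
case: m e qm @A E1 E2 => [|m] e qm A E1 E2 /=.
  move: A (qpoch (_ * q ^+ (_ + 1)) q j) E1 E2 => A B E1 E2.
  pose c := (1 + x * w * q ^+ j) * (1 - w * q ^+ (j + 1)) * (1 - w) *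
    (qpoch x q j * (1 - q * q ^+ j) / qpoch q q j.+1 * (- w) ^+ j).
  apply: (@lincomb _ _ _ (- c) _ _ E2); rewrite /c !qpoch0 invr1 !(qpochSr,qpoch0).
  rewrite !(addnS, addSn, addn0, add0n, exprS, exprD). ring.
have E3 : qpoch (w ^+ 2 * q ^+ (j.+1 + m + m + 2)) q j.+1
    = (1 - w ^+ 2 * q ^+ (j + m.+1 + m.+1 + 1)) * A.
  by rewrite pSl /A; congr ((1 - _ * _ ^+ _) * qpoch (_ * _ ^+ _) _ _); lia.
set C := qpoch (x * w ^+ 2 * q ^+ (j.+1 + m + 1)) q m.
have E4 : qpoch (x * w ^+ 2 * q ^+ (j.+1 + m.+1)) q m.+1
    = C * (1 - x * w ^+ 2 * q ^+ (j + m + m + 2)).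
  by rewrite pSr /C; congr (qpoch (_ * _ ^+ _) _ _ * (1 - _ * _ ^+ _)); lia.
have E5 : qpoch (x * w ^+ 2 * q ^+ (j + m.+1)) q m.+1
    = (1 - x * w ^+ 2 * q ^+ (j + m + 1)) * C.
  by rewrite pSl /C; congr ((1 - _ * _ ^+ _) * qpoch (_ * _ ^+ _) _ _); lia.
have E6 : qpoch (x * w ^+ 2 * q ^+ (j + m.+1 + 1)) q m.+1
    = C * (1 - x * w ^+ 2 * q ^+ (j + m + m + 2)).
  by rewrite -E4; congr (qpoch (_ * _ ^+ _) _ _); lia.
rewrite E3 E4 E5 E6 (qfactV qm) !(qpochSr q (w ^+ 2)) (qpochSr q x).
move: A (qpoch (_ * q ^+ (_ + 1)) q j) C E1 E2 {E3 E4 E5 E6} => A B C _ E2.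
move: (qpoch x q j) (qpoch (w ^+ 2) q m) (qpoch q q j.+1)^-1 (qpoch q q m.+1)^-1.
move=> X W Qj Qm.
pose c := (1 + x * w * q ^+ (j + m + 1)) * (1 - w * q ^+ (j + m + 2))
  * (1 - w * q ^+ m.+1) * (1 - q ^+ j.+1) * (1 - x * w ^+ 2 * q ^+ (j + m + 1))
  * (1 - w ^+ 2 * q ^+ m) * X * W * C * Qj * Qm * (- w) ^+ j.
apply: (@lincomb _ _ _ (- c) _ _ E2); rewrite /c.
by rewrite !(addnS, addSn, addn0, add0n, exprS, exprD); ring.
Qed.

(** Summing [sum65_wz], both shifted certificates have the same antidiagonal sum and cancel, leaving
    the first-order recurrence of the closed form. *)
Lemma sum65 N : qpoch q q N != 0 ->
  adsum N sum65_term
  = qpoch (- (x * w)) q N * qpoch (w ^+ 2 * q) (q ^+ 2) N * qpoch w q N.+1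
    / qpoch q q N.
Proof.
elim: N => [|N IH] qN.
  rewrite adsum0 /sum65_term qpochSr !qpoch0; field; exact: oner_neq0.
have /IH {}IH : qpoch q q N != 0 by apply: qpoch_neq0_le qN.
move: (qN); rewrite qpochSr -exprS mulf_eq0 negb_or => /andP[qN' qS].
apply: (mulfI qS); rewrite -adsumZ (eq_adsum (fun j k => @sum65_wz N j k qN)).
rewrite adsumD adsumB adsumZ !adsum_shiftl adsum_shiftr IH /sum65_ratio.
rewrite subrK [qpoch w q N.+2]qpochSr !(qpochSr _ _ N) -exprM.
rewrite mul2n -addnn !addn1 !(exprS, exprD) in qS *.
by field; rewrite qN' qS.
Qed.

End Sum65.

(** * Rogers polynomials and their Askey-Wilson expansion *)

Section Rogers.
Variables (F : fieldType) (q v a b : F).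

(** Homogeneous form: [a = e^(i t)] and [b = e^(-i t)] give the usual Rogers polynomial in
    [cos t]. *)
Definition rogers_term j k : F :=
  qpoch v q j * (qpoch q q j)^-1 * a ^+ j
  * (qpoch v q k * (qpoch q q k)^-1 * b ^+ k).

Definition rogers n : F := adsum n rogers_term.

(** The recurrence already holds summand by summand once multiplication by [a] or [b] is read as an
    index shift. *)
Lemma rogers_rec n : qpoch q q n.+2 != 0 ->
  (1 - q ^+ n.+2) * rogers n.+2
  = (1 - v * q ^+ n.+1) * ((a + b) * rogers n.+1)
    - a * b * (1 - v ^+ 2 * q ^+ n) * rogers n.
Proof.
move=> qn.
have pw j k : (j + k = n.+2)%N ->
    (1 - q ^+ n.+2) * rogers_term j k
    = (1 - v * q ^+ n.+1)
        * (a * shiftl rogers_term j k + b * shiftr rogers_term j k)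
      - a * b * (1 - v ^+ 2 * q ^+ n) * shiftl (shiftr rogers_term) j k.
  move=> e.
  have qj : qpoch q q j != 0 by apply: qpoch_neq0_le qn; lia.
  have qk : qpoch q q k != 0 by apply: qpoch_neq0_le qn; lia.
  case: j k e qj qk => [|j] [|k] e qj qk //=; rewrite /rogers_term ?(qpoch0, expr0).
  - rewrite (_ : k = n.+1); last by lia.
    by rewrite (_ : k = n.+1) in qk; last lia;
       rewrite (qfactV qk) !qpochSr !exprS; ring.
  - rewrite (_ : j = n.+1); last by lia.
    by rewrite (_ : j = n.+1) in qj; last lia;
       rewrite (qfactV qj) !qpochSr !exprS; ring.
  rewrite (_ : n = (j + k)%N); last by lia.
  by rewrite (qfactV qj) (qfactV qk) !qpochSr !(exprS, exprD); ring.
rewrite /rogers -adsumZ (eq_adsum pw) adsumB !adsumZ adsumD !adsumZ.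
by rewrite !adsum_shiftl !adsum_shiftr -mulrDl.
Qed.

Hypotheses (q0 : q != 0) (v0 : v != 0) (abv : a * b * v = 1).

(** Taken from the 4phi3 at [x = 1]: with [s^2 = q], the symbols of length [k] in [v], [-v], [vs],
    [-vs] multiply to [(v^2;q)_{2k}]. Dividing [(v^2;q)_{j+2k}] by it leaves [(v^2 q^{2k};q)_j], and
    [(v;q)_k] remains in the numerator. *)
Definition rogers_coef j k : F :=
  (- v^-1) ^+ j * v^-1 ^+ k * qpoch (v ^+ 2 * q ^+ (k + k)) q j * qpoch v q k
  * ((qpoch q q k)^-1 * (qpoch q q j)^-1) * (qtri q j k)^-1.

Definition aw_basis k : F := qpoch (- (a * v)) q k * qpoch (- (b * v)) q k.

(** Since [a b v = 1], the two new factors multiply to [1 + v q^(2k) + (a + b) v q^k]. *)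
Lemma aw_basisS k :
  (a + b) * aw_basis k
  = v^-1 * (q ^+ k)^-1 * (aw_basis k.+1 - (1 + v * q ^+ (k + k)) * aw_basis k).
Proof.
have qk : q ^+ k != 0 by rewrite expf_neq0.
apply: (mulfI v0); rewrite /aw_basis !qpochSr exprD.
move: (qpoch _ q k) (qpoch _ q k) (q ^+ k) qk => A B Q Q0.
pose c := - Q * v * A * B.
by apply: (lincomb (c := c) abv); rewrite /c; field; rewrite v0 Q0.
Qed.

(** The coefficient of [aw_basis k] in the recurrence of [rogers_rec], with [a + b] acting through
    [aw_basisS] and [a b] replaced by [v^-1]. *)
Lemma rogers_coef_rec n j k : qpoch q q n.+2 != 0 -> (j + k = n.+2)%N ->
  (1 - q ^+ n.+2) * rogers_coef j k
  = (1 - v * q ^+ n.+1) * v^-1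
    * (shiftr (fun j k => (q ^+ k)^-1 * rogers_coef j k) j k
       - shiftl (fun j k => (q ^+ k)^-1 * (1 + v * q ^+ (k + k))
                           * rogers_coef j k) j k)
    - v^-1 * (1 - v ^+ 2 * q ^+ n) * shiftl (shiftl rogers_coef) j k.
Proof.
move=> qn e.
have qj : qpoch q q j != 0 by apply: qpoch_neq0_le qn; lia.
have qk : qpoch q q k != 0 by apply: qpoch_neq0_le qn; lia.
have qX i : q ^+ i != 0 by rewrite expf_neq0.
(* [tl] and [tr] bring inverse powers of [q] to a common index, as [qfactV] does for
   q-factorials. *)
have tl i l : (qtri q i l)^-1 = q ^+ l * (qtri q i.+1 l)^-1.
  by rewrite qtriSl invfM mulrCA divff ?mulr1.
have tr i l : (qtri q i l)^-1 = q ^+ i * q ^+ l * (qtri q i l.+1)^-1.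
  rewrite qtriSr -[qtri _ _ _ * _ * _]mulrA invfM mulrCA.
  by rewrite divff ?mulr1 // mulf_neq0.
have pSl c i l : qpoch (c * q ^+ i) q l.+1
    = (1 - c * q ^+ i) * qpoch (c * q ^+ i.+1) q l.
  by rewrite qpochSl -mulrA -exprSr.
case: j e qj => [|j] e qj.
  rewrite add0n in e; rewrite e in qk *.
  rewrite /= /rogers_coef (tr 0 n.+1) !qpoch0 (qfactV qk) (qpochSr _ _ n.+1).
  move: (qpoch _ _ _) (qpoch _ _ _)^-1 (qtri _ _ _)^-1 => A B C.
  by rewrite !exprS; field; rewrite ?v0 ?q0 ?qX ?oner_neq0.
case: j e qj => [|j] e qj.
  have {}e : k = n.+1 by lia.
  rewrite e in qk *.
  rewrite /= /rogers_coef (qfactV qj) (tr 1%N n) (tl 0%N n.+1) (qfactV qk).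
  rewrite !(qpochSr _ (_ * _)) !qpoch0 (qpochSr _ _ n).
  move: (qpoch _ _ _) (qpoch _ _ _)^-1 (qpoch _ _ _)^-1 (qtri _ _ _)^-1 => A B C D.
  by rewrite !(addnS, addSn, exprS, exprD); field; rewrite ?v0 ?q0 ?qX ?oner_neq0.
have qj1 : qpoch q q j.+1 != 0 by apply: qpoch_neq0_le qj.
rewrite /=; case: k e qk => [|k] e qk.
  have -> : n = j by lia.
  rewrite /= /rogers_coef (tl j) (tl j.+1) (qfactV qj1) (qfactV qj).
  rewrite !(qpochSr _ (_ * _)) !qpoch0 !addn0.
  move: (qpoch _ _ _) (qpoch _ _ _)^-1 (qtri _ _ _)^-1 => A B C.
  by rewrite !exprS; field; rewrite ?v0 ?q0 ?qX ?oner_neq0.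
have -> : n = (j + k.+1)%N by lia.
rewrite /= /rogers_coef (tl j) (tl j.+1) (tr j.+2 k).
rewrite (qfactV qj1) (qfactV qj) (qfactV qk).
rewrite [qpoch (v ^+ 2 * q ^+ (k + k)) q j.+2]pSl.
rewrite [qpoch (_ * _ ^+ (k + k).+1) q _]pSl.
rewrite !(qpochSr _ (v ^+ 2 * _)) (qpochSr _ v) !addSn !addnS.
move: (qpoch _ _ _) (qpoch _ _ _) (qpoch _ _ _)^-1 (qpoch _ _ _)^-1 (qtri _ _ _)^-1.
move=> A B C D T.
by rewrite !(exprS, exprD); field; rewrite ?v0 ?q0 ?qX ?oner_neq0.
Qed.

Definition rogers_aw n : F := adsum n (fun j k => rogers_coef j k * aw_basis k).

Lemma rogers_aw_rec n : qpoch q q n.+2 != 0 ->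
  (1 - q ^+ n.+2) * rogers_aw n.+2
  = (1 - v * q ^+ n.+1) * ((a + b) * rogers_aw n.+1)
    - a * b * (1 - v ^+ 2 * q ^+ n) * rogers_aw n.
Proof.
move=> qn.
(* By [aw_basisS], [f] is the raising part and [g] the diagonal part of [(a + b) h], up to the
   factor [v^-1]. *)
pose f j k := (q ^+ k)^-1 * rogers_coef j k * aw_basis k.+1.
pose g j k := (q ^+ k)^-1 * (1 + v * q ^+ (k + k)) * rogers_coef j k * aw_basis k.
pose h j k := rogers_coef j k * aw_basis k.
have pw j k : (j + k = n.+2)%N ->
    (1 - q ^+ n.+2) * h j k
    = (1 - v * q ^+ n.+1) * v^-1 * (shiftr f j k - shiftl g j k)
      - v^-1 * (1 - v ^+ 2 * q ^+ n) * shiftl (shiftl h) j k.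
  move=> e; rewrite /h mulrA (rogers_coef_rec qn e) mulrBl -!mulrA.
  congr (_ * (_ * _) - _ * (_ * _)).
    rewrite mulrBl; congr (_ - _); first by case: k {e}; rewrite /= ?mul0r.
    by case: j {e}; rewrite /= ?mul0r.
  by case: j {e} => [|[|j]]; rewrite /= ?mul0r.
rewrite /rogers_aw -/h -adsumZ (eq_adsum pw) adsumB !adsumZ adsumB.
rewrite !adsum_shiftl adsum_shiftr -adsumB.
have -> : a * b = v^-1 by rewrite -[LHS](mulfK v0) abv mul1r.
congr (_ - _); rewrite -mulrA; congr (_ * _); rewrite -!adsumZ.
apply: eq_adsum => j k _; rewrite /f /g /h [RHS]mulrCA aw_basisS; ring.
Qed.

(** Both sides obey the same second-order recurrence, whose leading coefficient is nonzero, and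
    agree at 0 and 1; hence the induction on pairs. *)
Lemma rogersE n : qpoch q q n != 0 -> rogers n = rogers_aw n.
Proof.
suff: (qpoch q q n != 0 -> rogers n = rogers_aw n)
   /\ (qpoch q q n.+1 != 0 -> rogers n.+1 = rogers_aw n.+1) by case.
elim: n => [|n [IH0 IH1]].
  split=> [_|].
    rewrite /rogers /rogers_aw !adsum0 /rogers_term /rogers_coef /aw_basis /qtri.
    by rewrite !qpoch0; field; rewrite oner_neq0.
  rewrite qpochSr qpoch0 mul1r expr0 mulr1 => q1.
  rewrite /rogers /rogers_aw /adsum !big_ord_recl !big_ord0 /=.
  rewrite /rogers_term /rogers_coef /aw_basis /qtri /= !(qpochSr, qpoch0) ?mul1r.
  rewrite (_ : bump 0 0 = 1%N) // !bin_small //.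
  rewrite !(muln0, subnn, subn0, mul0n, addn0, expr0, expr1).
  by apply: (lincomb (c := - (1 - v) / (1 - q)) abv);
     field; rewrite ?q1 ?v0 ?oner_neq0.
split=> // qn; have q1 : qpoch q q n.+1 != 0 by apply: qpoch_neq0_le qn.
have q2 : qpoch q q n != 0 by apply: qpoch_neq0_le q1.
have qS : 1 - q ^+ n.+2 != 0.
  by move: qn; rewrite qpochSr -exprS mulf_eq0 negb_or => /andP[].
by apply: (mulfI qS); rewrite rogers_rec // rogers_aw_rec // IH0 // IH1.
Qed.

End Rogers.

(** * Rogers polynomials as 2phi1 series *)

Section Rogers21.
Variables (F : fieldType) (q v a : F).
Hypotheses (q0 : q != 0) (v0 : v != 0) (a0 : a != 0).

(** Termwise: reversing [(q;q)_{n-k}] and [(v;q)_{n-k}] cancels the signs and [qtri], and leaves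
    [(q/v)^k], which combines with [(b/a)^k] for [b = 1/(av)] into the argument of the series. *)
Lemma rogers_bhs n : qpoch q q n != 0 -> qpoch v q n != 0 ->
  a ^+ n * bhs n [:: (q ^+ n)^-1; v] [:: q / (q ^+ n * v)] q (q / (v ^+ 2 * a ^+ 2))
  = qpoch q q n / qpoch v q n * rogers q v a (a * v)^-1 n.
Proof.
rewrite /bhs /rogers /adsum !mulr_sumr => qn vn; apply: eq_bigr => -[k lek] _ /=.
have qk : qpoch q q k != 0 by apply: qpoch_neq0_le qn.
rewrite /bhs_term /rogers_term !(big_cons, big_nil) !mulr1.
have := qpoch_rev (n - k) k q0 v0; have := qpoch_rev (n - k) k q0 q0.
rewrite subnK // invfM [_^-1 / q]mulrC mulVKf // => qE vE.
have ak : a ^+ n = a ^+ (n - k) * a ^+ k by rewrite -exprD subnK.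
have zk : (q / (v ^+ 2 * a ^+ 2)) ^+ k = q ^+ k / ((v ^+ k) ^+ 2 * (a ^+ k) ^+ 2).
  by rewrite !(exprMn, exprVn).
move: qn vn; rewrite qE vE ak zk (exprNn q) (exprNn v) exprVn exprMn.
rewrite !mulf_eq0 !negb_or.
move=> /andP[/andP[/andP[h1 /andP[h2 h3]] h4] h5].
move=> /andP[/andP[/andP[h1' /andP[_ h3']] _] h5'].
have h6 : a ^+ k != 0 by rewrite expf_neq0.
move: ((-1) ^+ k) (q ^+ k) (v ^+ k) (a ^+ k) (a ^+ (n - k)) h2 h3 h3' h6.
move: (qtri _ _ _) (qpoch (q ^- n) _ _) (qpoch (q / _) _ _) h4 h5 h5'.
move: (qpoch q q _) (qpoch q q _) (qpoch v q _) (qpoch v q _) h1 h1' qk.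
by move=> *; field; do !(apply/andP; split).
Qed.

End Rogers21.

(** * Reduction of the inner sum to the 6phi5 *)

Section Assembly.
Variables (F : fieldType) (q v x : F).
Hypotheses (q0 : q != 0) (v0 : v != 0).

(** The weight of [rogers n] in [H] for [r = j + n], once [u] has cancelled and [rogers_bhs] has
    been applied. *)
Definition connection_coef j n : F :=
  qpoch q q (j + n) * (qpoch x q j / qpoch q q j)
  / (qpoch v q n * qpoch (v * q ^+ (n + 1)) q j)
  * (qpoch (v ^+ 2 * q ^+ (j + n + n + 1)) q j
     / qpoch (x * v ^+ 2 * q ^+ (j + n + n)) q j).

(** Isolates the dependence on [m] at fixed [k] and [j + m]: the prefactor of [sum65_term] involves
    only [k] and [j + m]. *)
Lemma connection_sum65 j m k :
  qpoch v q (j + m + k).+1 != 0 ->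
  qpoch (x * v ^+ 2 * q ^+ (j + m + k + k)) q (j + m) != 0 ->
  connection_coef j (k + m) * rogers_coef q v m k
  = qpoch q q (j + m + k) * (- v^-1) ^+ (j + m) * v^-1 ^+ k
    / (qpoch q q k * qtri q (j + m) k * qpoch (v * q ^+ k) q (j + m).+1
       * qpoch (x * v ^+ 2 * q ^+ (j + m + k + k)) q (j + m))
    * sum65_term q (v * q ^+ k) x j m.
Proof.
move=> hvr hxr.
have qX i : q ^+ i != 0 by rewrite expf_neq0.
have w2 : (v * q ^+ k) ^+ 2 = v ^+ 2 * q ^+ (k + k).
  by rewrite exprMn -exprM muln2 addnn.
(* The denominator of [connection_coef] skips one factor of [(v;q)_{j+m+k+1}]; it becomes the
   very-well-poised factor [1 - w q^m]. *)
have f1 : qpoch v q k * qpoch (v * q ^+ k) q (j + m).+1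
    = qpoch v q (k + m) * (1 - v * q ^+ k * q ^+ m)
      * qpoch (v * q ^+ (k + m + 1)) q j.
  rewrite -qpochD -[v * _ * _]mulrA -exprD -qpochSr addn1 -qpochD.
  by congr qpoch; lia.
have f1n : qpoch v q k * qpoch (v * q ^+ k) q (j + m).+1 != 0.
  by rewrite -qpochD (_ : (k + _ = (j + m + k).+1)%N) //; lia.
have f2 : qpoch (x * v ^+ 2 * q ^+ (j + m + k + k)) q (j + m)
    = qpoch (x * v ^+ 2 * q ^+ (j + m + k + k)) q m
      * qpoch (x * v ^+ 2 * q ^+ (j + (k + m) + (k + m))) q j.
  rewrite [in LHS](addnC j m) qpochD -[_ * _ * q ^+ m]mulrA -exprD.
  by congr (qpoch (_ * _ ^+ _) _ _ * qpoch (_ * _ ^+ _) _ _); lia.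
have f3 : x * (v * q ^+ k) ^+ 2 * q ^+ (j + m) = x * v ^+ 2 * q ^+ (j + m + k + k).
  by rewrite w2 mulrA -mulrA -exprD; congr (_ * _ ^+ _); lia.
have f4 : (v * q ^+ k) ^+ 2 * q ^+ (j + m + m + 1)
    = v ^+ 2 * q ^+ (j + (k + m) + (k + m) + 1).
  by rewrite w2 -mulrA -exprD; congr (_ * _ ^+ _); lia.
(* This produces the power [(-w)^j] of [sum65_term]. *)
have f5 : (qtri q m k)^-1 * (- v^-1) ^+ m
    = (qtri q (j + m) k)^-1 * (- v^-1) ^+ (j + m) * (- (v * q ^+ k)) ^+ j.
  have -> : qtri q m k = qtri q (j + m) k / q ^+ (j * k).
    by rewrite addnC qtriDl mulfK.
  have vq : (- v^-1) ^+ j * (- (v * q ^+ k)) ^+ j = q ^+ (j * k).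
    by rewrite -exprMn mulrNN mulKf // -exprM mulnC.
  by rewrite invf_div exprD -vq; ring.
rewrite /connection_coef /rogers_coef /sum65_term f3 f4 w2 f2.
rewrite (_ : (j + m + k = j + (k + m))%N); last by lia.
have [xm xj] : qpoch (x * v ^+ 2 * q ^+ (j + m + k + k)) q m != 0
    /\ qpoch (x * v ^+ 2 * q ^+ (j + (k + m) + (k + m))) q j != 0.
  by apply/andP; rewrite -negb_or -mulf_eq0 -f2.
rewrite (_ : (j + m + k + k = j + (k + m) + k)%N) in xm; last by lia.
have g : qpoch v q k / (qpoch v q (k + m) * qpoch (v * q ^+ (k + m + 1)) q j)
    = (1 - v * q ^+ k * q ^+ m) / qpoch (v * q ^+ k) q (j + m).+1.
  have h3 : qpoch (v * q ^+ k) q (j + m).+1 != 0.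
    by apply: contraNneq f1n => ->; rewrite mulr0.
  move: f1n; rewrite f1 mulrAC mulf_eq0 negb_or => /andP[h1 _].
  by apply/eqP; rewrite eqr_div // f1; apply/eqP; ring.
set X := qpoch _ q m in xm *; set Y := qpoch _ q j in xj *.
set Q := qpoch q q (j + _).
set P := v^-1 ^+ k * qpoch x q j * (qpoch q q j)^-1 * (qpoch q q k)^-1
  * (qpoch q q m)^-1
  * qpoch (v ^+ 2 * q ^+ (k + k)) q m
  * qpoch (v ^+ 2 * q ^+ (j + (k + m) + (k + m) + 1)) q j.
transitivity (Q * P / Y
     * (qpoch v q k / (qpoch v q (k + m) * qpoch (v * q ^+ (k + m + 1)) q j))
     * ((qtri q m k)^-1 * (- v^-1) ^+ m)).
  by rewrite /P; ring.
rewrite g f5 /P !invfM.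
transitivity (X * X^-1 * (Q * P / Y
  * ((1 - v * q ^+ k * q ^+ m) / qpoch (v * q ^+ k) q (j + m).+1)
  * ((qtri q (j + m) k)^-1 * (- v^-1) ^+ (j + m) * (- (v * q ^+ k)) ^+ j))).
  by rewrite divff // mul1r.
by rewrite /P; ring.
Qed.

End Assembly.

(** * Expansion of [H] and comparison with the 4phi3 *)

Unset Implicit Arguments.

(* [s] is the square root q^{1/2}. Genericity of the parameters is the
   assumption that no denominator occurring in the identity vanishes. *)
Theorem theorem2 (F : fieldType) (q s a u v x : F) (r : nat)
  (hs : s ^+ 2 = q)
  (hq : q != 0) (ha : a != 0) (hv : v != 0)
  (hqr : qpoch q q r != 0)
  (hur : qpoch u q r != 0)
  (hphi : forall i : nat, (i <= r)%N ->
    qpoch (q ^ (1 + i%:Z - r%:Z) / v) q (r - i) != 0)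
  (hvi : forall i : nat, (i <= r)%N -> qpoch (v * q ^+ (r - i + 1)) q i != 0)
  (hxvi : forall i : nat, (i <= r)%N ->
    qpoch (x * v ^+ 2 * q ^+ (2 * r - i)) q i != 0)
  (hxv2 : qpoch (x * v ^+ 2) q (2 * r) != 0)
  (hxv : qpoch (x * v) q r != 0)
  (hvs : qpoch (v * s) q r != 0)
  (hNvs : qpoch (- (v * s)) q r != 0)
  (hNxv : qpoch (- (x * v)) q r != 0)
  (H : F)
  (HE : qpoch u q r / qpoch q q r * H =
    \sum_(0 <= i < r.+1)
      a ^+ (r - i) * (qpoch u q (r - i) / qpoch q q (r - i))
      * bhs (r - i) [:: q ^ (i%:Z - r%:Z); v] [:: q ^ (1 + i%:Z - r%:Z) / v]
          q (q / (v ^+ 2 * a ^+ 2))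
      * (qpoch x q i / qpoch q q i)
      * (qpoch (u * q ^+ (r - i)) q i / qpoch (v * q ^+ (r - i + 1)) q i)
      * (qpoch (v ^+ 2 * q ^+ (2 * r - i + 1)) q i
         / qpoch (x * v ^+ 2 * q ^+ (2 * r - i)) q i)) :
  H = (- 1 / v) ^+ r
      * (qpoch (x * v ^+ 2) q r / qpoch (x * v ^+ 2) q (2 * r))
      * (qpoch (x ^+ 2 * v ^+ 2) (q ^+ 2) r * qpoch (v ^+ 2 * q) (q ^+ 2) r
         / qpoch (x * v) q r)
      * bhs r [:: q ^- r; x * v ^+ 2 * q ^+ r; - (a * v); - 1 / a]
          [:: v * s; - (v * s); - (x * v)] q q.
Proof.
have qX i : q ^+ i != 0 by rewrite expf_neq0.
(* For [r = 0] the hypotheses allow [v = 1], whereas the argument below divides by factors of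
   [(v;q)_{r+1}]. *)
case: (posnP r) => [r0|r_gt0].
  subst r; move: HE; rewrite big_nat1 /bhs !big_ord1 /bhs_term !(big_cons, big_nil).
  by rewrite !qpoch0 !expr0 ?(invr1, mulr1, mul1r).
(* The denominator symbol of the 2phi1 at [i = 0] is [(v;q)_r] reversed. *)
have vr : qpoch v q r != 0.
  have := hphi 0%N isT; rewrite subn0 => h.
  have := @qpoch_rev _ q v 0 r hq hv; rewrite qpoch0 mul1r add0n => ->.
  rewrite !mulf_neq0 ?expf_neq0 ?oppr_eq0 //.
  have -> : q / (q ^+ r * v) = q ^ (1 + 0%N%:Z - r%:Z) / v; last exact: h.
  by rewrite addr0 expfzDr // -exprnN expr1z invfM mulrA.
have vSr : qpoch v q r.+1 != 0.
  have := hvi r (leqnn r); rewrite subnn expr1 qpochSl mulf_eq0 negb_or => ->.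
  rewrite andbT.
  by apply: contraNneq vr => h; case: (r) r_gt0 => // r' _; rewrite qpochSl h mul0r.
(* Here [n = r - i], and [u] leaves through [(u;q)_n (u q^n;q)_{r-n} = (u;q)_r]. *)
have HH : H = \sum_(n < r.+1)
    connection_coef q v x (r - n) n * rogers q v a (a * v)^-1 n.
  have uq : qpoch u q r / qpoch q q r != 0 by rewrite mulf_neq0 ?invr_eq0.
  apply: (mulfI uq); rewrite HE big_mkord (reindex_inj rev_ord_inj) /= mulr_sumr.
  apply: eq_bigr => -[n len] _ /=; rewrite subSS.
  rewrite ltnS in len.
  have qn : qpoch q q n != 0 by apply: qpoch_neq0_le hqr.
  have vn : qpoch v q n != 0 by apply: qpoch_neq0_le vr.
  have un : qpoch u q r = qpoch u q n * qpoch (u * q ^+ n) q (r - n).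
    by rewrite -qpochD subnKC.
  have e1 : q ^ ((r - n)%N%:Z - r%:Z) = (q ^+ n)^-1.
    by rewrite -subzn // addrAC subrr add0r -exprnN.
  have e2 : q ^ (1 + (r - n)%N%:Z - r%:Z) / v = q / (q ^+ n * v).
    by rewrite -addrA expfzDr // e1 expr1z invfM mulrA.
  rewrite e1 e2 subKn //.
  have e3 : (2 * r - (r - n) = r - n + n + n)%N by clear - len; lia.
  rewrite e3 /connection_coef subnK //.
  have E := rogers_bhs hq hv ha qn vn.
  rewrite un (invfM (qpoch v q n)); move: hqr qn vn E.
  move: (bhs _ _ _ _ _) (rogers _ _ _ _ _) (qpoch x q _ / _).
  move: (_ / qpoch (x * _ * _) q _).
  move: (qpoch (v * _) q _)^-1 (qpoch q q r) (qpoch q q n) (qpoch v q n) (a ^+ n).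
  move: (qpoch u q n) (qpoch _ q (r - n)).
  clear=> U Ur B Qr Qn V A Y b R X Qr0 Qn0 V0 E.
  by apply: (lincomb (c := U / Qn * X * Ur * B * Y) E); field; rewrite Qr0 Qn0 V0.
have abv : a * (a * v)^-1 * v = 1 by field; rewrite ha hv.
pose h n k := connection_coef q v x (r - n) n
  * (rogers_coef q v (n - k) k * aw_basis q v a (a * v)^-1 k).
have {HE}-> : H = \sum_(n < r.+1) \sum_(k < n.+1) h n k.
  rewrite HH; apply: eq_bigr => -[n len] _ /=.
  have qn : qpoch q q n != 0 by apply: qpoch_neq0_le hqr.
  by rewrite (rogersE hq hv abv qn) mulr_sumr.
(* With [n = k + m], the sum over [m] at fixed [k] has to be the [k]-th term of the 4phi3. *)
rewrite sum_triangle /bhs mulr_sumr; apply: eq_bigr => -[k lek] _ /=.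
rewrite ltnS in lek.
have [N eN] : exists N, r = (N + k)%N by exists (r - k)%N; rewrite subnK.
(* The middle symbol is the numerator symbol in [x v^2 q^r] of the 4phi3; the last is the
   denominator left by [connection_sum65]. *)
have fx : qpoch (x * v ^+ 2) q (2 * r)
    = qpoch (x * v ^+ 2) q r * (qpoch (x * v ^+ 2 * q ^+ r) q k
      * qpoch (x * v ^+ 2 * q ^+ (r + k)) q N).
  rewrite (_ : 2 * r = r + (k + N))%N; last by clear -eN lek; lia.
  by rewrite !qpochD -[_ * _ * q ^+ k]mulrA -exprD.
move: (hxv2); rewrite fx !mulf_eq0 !negb_or => /and3P[x1 x2 x3].
have qN : qpoch q q N != 0 by apply: qpoch_neq0_le hqr; clear -eN lek; lia.
have qk : qpoch q q k != 0 by apply: qpoch_neq0_le hqr; clear -eN lek; lia.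
have rN : (r - k = N)%N by clear -eN; lia.
pose C := qpoch q q r * (- v^-1) ^+ N * v^-1 ^+ k
    / (qpoch q q k * qtri q N k * qpoch (v * q ^+ k) q N.+1
       * qpoch (x * v ^+ 2 * q ^+ (r + k)) q N).
transitivity (C * adsum N (sum65_term q (v * q ^+ k) x)
              * aw_basis q v a (a * v)^-1 k).
  rewrite rN /adsum mulr_sumr mulr_suml; apply: eq_bigr => -[m lem] _ /=.
  rewrite ltnS in lem.
  rewrite /h addKn mulrA; congr (_ * _).
  rewrite (_ : r - (k + m) = N - m)%N; last by clear -eN lem; lia.
  have := @connection_sum65 _ q v x hq hv (N - m) m k.
  by rewrite subnK // -eN => ->.
have hw : qpoch (v * q ^+ k) q N.+1 != 0.
  move: vSr; rewrite (_ : r.+1 = k + N.+1)%N; last by clear -eN lek; lia.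
  by rewrite qpochD mulf_eq0 negb_or => /andP[].
(* Reversing [(q;q)_r] supplies the numerator parameter [q^-r]. *)
have fq := @qpoch_rev _ q q N k hq hq.
have fq' : q / (q ^+ (N + k) * q) = q ^- r by rewrite eN invfM [_ / q]mulrC mulVKf.
(* [fm] and [fv] split the base [q^2] symbols of the prefactor: the parts of length [k] cancel
   denominators of the 4phi3 term, and those of length [N] match [sum65]. *)
have fm : qpoch (x ^+ 2 * v ^+ 2) (q ^+ 2) r
    = qpoch (x * v) q r * (qpoch (- (x * v)) q k
                          * qpoch (- (x * (v * q ^+ k))) q N).
  rewrite -exprMn -qpochM_opp eN addnC; congr (_ * _).
  by rewrite qpochD mulNr mulrA.
have fv : qpoch (v ^+ 2 * q) (q ^+ 2) r
    = qpoch (v * s) q k * qpoch (- (v * s)) q k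
      * qpoch ((v * q ^+ k) ^+ 2 * q) (q ^+ 2) N.
  rewrite qpochM_opp exprMn hs eN addnC qpochD; congr (_ * qpoch _ _ _).
  by rewrite -[(q ^+ 2) ^+ k]exprM mulnC exprM; ring.
have s1 : qpoch (v * s) q k != 0 by apply: qpoch_neq0_le hvs.
have s2 : qpoch (- (v * s)) q k != 0 by apply: qpoch_neq0_le hNvs.
have s3 : qpoch (- (x * v)) q k != 0 by apply: qpoch_neq0_le hNxv.
have tri0 : qtri q N k != 0 by exact: qX.
have fb : - 1 / a = - ((a * v)^-1 * v) by field; rewrite ha hv.
rewrite sum65 // /C /bhs_term !(big_cons, big_nil) !mulr1 fm fv fb /aw_basis.
have -> : qpoch q q r = qpoch q q N * (- q) ^+ k * qtri q N k * qpoch (q ^- r) q k.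
  by rewrite -fq' -fq -eN.
have -> : (- 1 / v) ^+ r = (- v^-1) ^+ N * ((-1) ^+ k * v^-1 ^+ k).
  by rewrite mulN1r eN exprD (exprNn v^-1 k).
rewrite (exprNn q).
move: (qpoch (- (x * (v * q ^+ k))) q N) (qpoch _ (q ^+ 2) N).
move: (qpoch (v * q ^+ k) q N.+1) (qpoch (v * s) q k) (qpoch (- (v * s)) q k)
  (qpoch (- (x * v)) q k) (qtri q N k) (qpoch q q k) (qpoch q q N)
  (qpoch (x * v) q r) (qpoch (x * v ^+ 2) q r) (qpoch (x * v ^+ 2 * q ^+ r) q k)
  (qpoch (_ * q ^+ (r + k)) q N) hw s1 s2 s3 tri0 qk qN hxv x1 x2 x3.
move: (qpoch (q ^- r) q k) (v^-1 ^+ k) ((- v^-1) ^+ N) ((-1) ^+ k) (q ^+ k).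
move: (qpoch _ q k) (qpoch _ q k).
by clear; move=> *; field; do !(apply/andP; split).
Qed.
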